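(* Let $S_1,\ldots,S_d$ be permutations of an $N$-element set, and define their cycle excess by $$E=\sum_{c=1}^d\bigl(\mathrm{cyc}(S_c)-1\bigr).$$ Then $$\prod_{c=1}^d\mathrm{sgn}(S_c)=(-1)^{d(N-1)}(-1)^E.$$ For even $m\ge 2$ and odd $d\ge3$, every factorization of $D_d(m)$ whose product of permutation signs equals that of the canonical coordinate factorization therefore has odd cycle excess; in particular the least nonnegative excess allowed by this parity condition is $1$.
   Context: $\mathrm{cyc}(S)$ is the number of cycles in the complete cycle decomposition of $S$, including fixed points. $D_d(m)$ is the digraph on $\mathbb Z_m^d$ with arcs $x\to x+e_i$ ($1\le i\le d$). A factorization of $D_d(m)$ is a list of permutations $S_1,\dots,S_d$ of $\mathbb Z_m^d$ such that at each vertex $x$ the values $S_1(x),\dots,S_d(x)$ are $x+e_1,\dots,x+e_d$ in some order. The canonical coordinate factorization is $S_c(x)=x+e_c$. *)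

(* Defs.v *)
From HB Require Import structures.
From mathcomp Require Import all_boot all_order all_algebra all_fingroup.

Set Implicit Arguments.
Unset Strict Implicit.
Unset Printing Implicit Defensive.

Import GRing.Theory.
Local Open Scope ring_scope.

Definition sgn (T : finType) (s : {perm T}) : int := (-1) ^+ odd_perm s.

(* [porbits s] contains the singleton orbits of fixed points. *)
Definition cyc (T : finType) (s : {perm T}) : nat := #|porbits s|.

(* Valued in [int], so that the subtraction is not truncated when [T] is empty
   (then [cyc] is 0 and every term is -1). *)
Definition cycle_excess (T : finType) (d : nat) (S : 'I_d -> {perm T}) : int :=
  \sum_(c < d) ((cyc (S c))%:Z - 1).

Definition sgn_prod (T : finType) (d : nat) (S : 'I_d -> {perm T}) : int :=
  \prod_(c < d) sgn (S c).

(* Z_m^d; this is the intended set only for m >= 2, since ['Z_0] and ['Z_1]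
   both denote Z/2. *)
Notation torus m d := 'rV['Z_m]_d.

(* The head of the [i]-th arc of D_d(m) with tail [x]. *)
Definition arc_head (m d : nat) (x : torus m d) (i : 'I_d) : torus m d :=
  x + delta_mx 0 i.

Definition is_factorization (m d : nat) (S : 'I_d -> {perm torus m d}) : Prop :=
  forall x : torus m d,
    exists sigma : 'S_d, forall c : 'I_d, S c x = arc_head x (sigma c).

Lemma arc_head_inj (m d : nat) (c : 'I_d) :
  injective (fun x : torus m d => arc_head x c).
Proof. exact: addIr. Qed.

Definition canonical (m d : nat) (c : 'I_d) : {perm torus m d} :=
  perm (@arc_head_inj m d c).

Lemma canonical_is_factorization (m d : nat) : is_factorization (@canonical m d).
Proof. by move=> x; exists 1%g => c; rewrite permE perm1. Qed.

(* The constraint that the sign identity puts on an excess [e] when the product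
   of signs is that of the canonical coordinate factorization. *)
Definition parity_allowed (m d : nat) (e : int) : Prop :=
  sgn_prod (@canonical m d)
  = (-1) ^ (d%:Z * ((#|{: torus m d}|)%:Z - 1)) * (-1) ^ e.

(* Main.v *)
Require Import Defs.
From mathcomp Require Import all_boot all_order all_algebra all_fingroup.

(** The sign of a permutation is (-1) to the number of points minus the number
    of cycles.  Subtracting 1 from both counts leaves the difference alone, so
    sgn s = (-1)^(N - 1) * (-1)^(cyc s - 1), and multiplying over the d colours
    turns the second factors into (-1)^E ([sgn_prodE]).

    For the torus, the translation by e_c splits Z_m^d into m^(d-1) cycles, all
    of length m ([cyc_canonical]).  When m is even and d >= 2, both m^d and
    m^(d-1) are even, hence every canonical translation is an even permutation
    and the canonical product of signs is 1 ([sgn_prod_canonical]).  If d is odd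
    as well, then d (m^d - 1) is odd, so that the sign identity reads
    1 = - (-1)^E: the excess is odd, and among nonnegative integers the smallest
    odd one is 1 ([parity_allowedE]). *)

Import Order.TTheory GRing.Theory Num.Theory.
Local Open Scope ring_scope.

(** [odd_perm] is by definition the parity of #|T| plus the number of cycles.
    The two exponents lowered by 1 cost two factors -1, which cancel; the
    identity thus survives on the empty type, where both exponents are -1. *)
Lemma sgnE (T : finType) (s : {perm T}) :
  sgn s = (-1) ^ (#|T|%:Z - 1) * (-1) ^ ((cyc s)%:Z - 1).
Proof.
rewrite /sgn /odd_perm -/(cyc s) signr_addb !signr_odd.
rewrite !exprzDr // !exprN1 invrN1 mulrACA mulrNN !mulr1.
by rewrite !exprnP.
Qed.

Lemma sgn_prodE (d : nat) (T : finType) (S : 'I_d -> {perm T}) :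
  sgn_prod S = (-1) ^ (d%:Z * (#|T|%:Z - 1)) * (-1) ^ (cycle_excess S).
Proof.
rewrite /sgn_prod (eq_bigr _ (fun c _ => sgnE _ (S c))) big_split /=.
congr (_ * _).
  by rewrite prodr_const card_ord mulrC -exprz_exp exprnP.
rewrite /cycle_excess; symmetry.
by apply: (big_morph (fun e : int => (-1) ^ e)) => // x y; rewrite exprzDr.
Qed.

(** The cycles of s are the orbits of the cyclic group <[s]>, hence they
    partition T. *)
Lemma cyc_uniform (T : finType) (s : {perm T}) (n : nat) :
  (forall x, #|porbit s x| = n) -> #|T| = (cyc s * n)%N.
Proof.
move=> card_s; rewrite -cardsT /cyc; apply: card_uniform_partition.
  by move=> _ /imsetP[x _ ->].
have -> : porbits s = [set orbit 'P <[s]> x | x in [set: T]].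
  rewrite /porbits; apply/setP=> A.
  by apply/imsetP/imsetP=> -[x _ ->]; exists x; rewrite ?inE // porbitE.
by apply: orbit_partition; apply/actsP=> a _ x; rewrite !inE.
Qed.

Lemma canonicalX (m d : nat) (c : 'I_d) (k : nat) (x : torus m d) :
  (canonical m c ^+ k)%g x = x + k%:R *: delta_mx 0 c.
Proof.
elim: k => [|k IHk]; first by rewrite perm1 scale0r addr0.
by rewrite expgSr permM IHk permE /arc_head -natr1 scalerDl scale1r addrA.
Qed.

(** The cycle through x is the line x + Z_m e_c; its parametrization by Z_m is
    injective, as the coordinate c recovers the parameter. *)
Lemma card_porbit_canonical (m d : nat) (c : 'I_d) (x : torus m d) :
  (1 < m)%N -> #|porbit (canonical m c) x| = m.
Proof.
move=> m_gt1.
have -> : porbit (canonical m c) x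
          = [set x + k *: delta_mx 0 c | k : 'Z_m].
  apply/setP=> y; apply/porbitP/imsetP=> [[k ->]|[k _ ->]].
    by exists k%:R; rewrite // canonicalX.
  by exists k; rewrite canonicalX natr_Zp.
rewrite card_imset ?card_ord ?Zp_cast // => k1 k2 /addrI/rowP/(_ c).
by rewrite !mxE !eqxx !mulr1.
Qed.

Lemma card_torus (m d : nat) : (1 < m)%N -> #|{: torus m d}| = (m ^ d)%N.
Proof. by move=> m_gt1; rewrite card_mx card_ord Zp_cast // mul1n. Qed.

Lemma cyc_canonical (m d : nat) (c : 'I_d) :
  (1 < m)%N -> cyc (canonical m c) = (m ^ d.-1)%N.
Proof.
move=> m_gt1; apply/eqP; rewrite -(eqn_pmul2r (ltnW m_gt1)).
rewrite -(cyc_uniform _ (canonical m c) m); last first.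
  by move=> x; apply: card_porbit_canonical.
by rewrite card_torus // -expnSr prednK // (leq_trans _ (ltn_ord c)).
Qed.

Lemma sgn_prod_canonical (m d : nat) :
  (1 < m)%N -> ~~ odd m -> (1 < d)%N -> sgn_prod (@canonical m d) = 1.
Proof.
move=> m_gt1 m_even d_gt1; apply: big1 => c _.
rewrite /sgn /odd_perm -/(cyc _) cyc_canonical // card_torus //.
by rewrite !oddX (negPf m_even) !orbF; case: d d_gt1 c => [|[]].
Qed.

(** With the canonical product of signs equal to 1 and d (m^d - 1) odd, the
    sign identity constrains exactly the parity of the excess. *)
Lemma parity_allowedE (m d : nat) (e : int) :
  (1 < m)%N -> ~~ odd m -> (1 < d)%N -> odd d ->
  parity_allowed m d e <-> odd `|e|%N.
Proof.
move=> m_gt1 m_even d_gt1 d_odd.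
rewrite /parity_allowed sgn_prod_canonical // card_torus //.
have N_even : odd (m ^ d) = false.
  by rewrite oddX (negPf m_even) orbF; case: d d_gt1 {d_odd}.
have -> : (-1) ^ (d%:Z * ((m ^ d)%:Z - 1)) = -1 :> int.
  rewrite -exprz_exp -exprnP -signr_odd d_odd expr1.
  by rewrite exprzDr // -exprnP -signr_odd N_even exprN1 invrN1 mul1r.
by rewrite expN1r -signr_odd; case: odd.
Qed.

Theorem proposition5p4 :
  (forall (d N : nat) (T : finType) (S : 'I_d -> {perm T}),
     #|T| = N ->
     sgn_prod S = (-1) ^ (d%:Z * (N%:Z - 1)) * (-1) ^ (cycle_excess S))
  /\
  (forall m d : nat, (2 <= m)%N -> ~~ odd m -> (3 <= d)%N -> odd d ->
     (forall S : 'I_d -> {perm torus m d},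
        is_factorization S ->
        sgn_prod S = sgn_prod (@canonical m d) ->
        odd `|cycle_excess S|%N)
     /\
     (parity_allowed m d 1 /\
      forall e : int, 0 <= e -> parity_allowed m d e -> 1 <= e)).
Proof.
split=> [d N T S <-|m d m_gt1 m_even d_ge3 d_odd]; first exact: sgn_prodE.
have allowedE e := parity_allowedE m d e m_gt1 m_even (ltnW d_ge3) d_odd.
split=> [S _ sgnS|].
  by apply/allowedE; rewrite /parity_allowed -sgnS; apply: sgn_prodE.
split=> [|e e_ge0 /allowedE e_odd]; first exact/allowedE.
by rewrite -gtz0_ge1 lt_neqAle e_ge0 andbT; apply: contraTneq e_odd => <-.
Qed.
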